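(* Let $N \geq 1$. Then there exists a constant $C = C(N) > 0$ such that for all $0 < s \leq t < 1$ and all $f \in \mathscr{S}(\mathbb{R}^N)$, $$\min\{s,1-s\}^{1/2}\, [f]_{\dot W^{s,2}(\mathbb{R}^N)} \leq C \left( \|f\|_{L^2(\mathbb{R}^N)} + \min\{t,1-t\}^{1/2}\, [f]_{\dot W^{t,2}(\mathbb{R}^N)}\right).$$
   Context: $\mathscr{S}(\mathbb{R}^N)$ is the space of Schwartz functions on $\mathbb{R}^N$. Gagliardo seminorm: for $s\in(0,1)$, $p\in(1,\infty)$, $$[f]_{\dot W^{s,p}(\mathbb{R}^N)} := \left(\int_{\mathbb{R}^N}\int_{\mathbb{R}^N} \frac{|f(x)-f(y)|^p}{|x-y|^{N+sp}}\, dx\, dy\right)^{1/p}.$$ *)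

(* Defs.v *)
From HB Require Import structures.
From mathcomp Require Import all_boot all_order all_algebra.
From mathcomp Require Import all_classical all_reals all_analysis.
From mathcomp.real_closed Require Import complex.

Set Implicit Arguments.
Unset Strict Implicit.
Unset Printing Implicit Defensive.

Import Order.TTheory GRing.Theory Num.Theory.
Import numFieldTopology.Exports numFieldNormedType.Exports.

Local Open Scope classical_set_scope.
Local Open Scope ring_scope.

Definition rV_display : measure_display.
Proof. exact: default_measure_display. Qed.

(* R^N is equipped with the sigma-algebra generated by the coordinate maps,
   i.e. the Borel sigma-algebra; same construction as the instance of
   MathComp-Analysis on tuples. *)
Section measurable_rV.
Context {R : realType} (N : nat).

Let coord (i : 'I_N) (x : 'rV[R]_N) : measurableTypeR R := x 0 i.

Let rV_set0 : g_sigma_preimage coord set0.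
Proof. exact: sigma_algebra0. Qed.

Let rV_setC A : g_sigma_preimage coord A -> g_sigma_preimage coord (~` A).
Proof. exact: sigma_algebraC. Qed.

Let rV_bigcup (F : (set 'rV[R]_N)^nat) :
  (forall i, g_sigma_preimage coord (F i)) ->
  g_sigma_preimage coord (\bigcup_i (F i)).
Proof. exact: sigma_algebra_bigcup. Qed.

HB.instance Definition _ := @isMeasurable.Build rV_display 'rV[R]_N
  (g_sigma_preimage coord) rV_set0 rV_setC rV_bigcup.

End measurable_rV.

Section lebesgue_rV.
Context {R : realType}.

Definition cons_rV N (p : measurableTypeR R * 'rV[R]_N) : 'rV[R]_N.+1 :=
  \row_i if unlift ord0 i is Some j then p.2 0 j else p.1.

(* N-dimensional Lebesgue measure on the Borel sets: the N-fold product of the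
   one-dimensional Lebesgue measure (see lebesgue_rV_box). *)
Fixpoint lebesgue_rV N : set 'rV[R]_N -> \bar R :=
  match N with
  | 0 => \d_(0 : 'rV[R]_0)
  | N'.+1 => pushforward (lebesgue_measure \x lebesgue_rV (N := N'))%E
               (@cons_rV N')
  end.

Lemma cons_rV0 N p : @cons_rV N p 0 ord0 = p.1.
Proof. by rewrite mxE unlift_none. Qed.

Lemma cons_rVS N p (i : 'I_N) : @cons_rV N p 0 (lift ord0 i) = p.2 0 i.
Proof. by rewrite mxE liftK. Qed.

Lemma measurable_coord_rV N (i : 'I_N) :
  measurable_fun [set: 'rV[R]_N]
    (fun x : 'rV[R]_N => x 0 i : measurableTypeR R).
Proof.
move=> _ Y mY; rewrite setTI; apply: sub_sigma_algebra => /=.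
rewrite -bigcup_seq/=; exists i => /=; first by rewrite mem_index_enum.
by exists Y => //; rewrite setTI.
Qed.

Lemma measurable_fun_rVP d (T : measurableType d) N (f : T -> 'rV[R]_N) :
  measurable_fun [set: T] f <->
  forall i, measurable_fun [set: T] (fun x => f x 0 i : measurableTypeR R).
Proof.
split=> [mf i|mf].
  exact: (measurableT_comp (measurable_coord_rV i) mf).
move=> _; suff : @measurable _ 'rV[R]_N `<=` [set Y | measurable (f @^-1` Y)].
  by move=> sub Y mY; rewrite setTI; exact: sub.
apply: smallest_sub.
  split => [|A mA|F mF] /=.
  - by rewrite preimage_set0.
  - by rewrite setTD preimage_setC; exact: measurableC.
  - by rewrite preimage_bigcup; exact: bigcupT_measurable.
rewrite -bigcup_seq/= => A [i _ [B mB <-]] /=.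
by rewrite setTI; have := mf i measurableT B mB; rewrite setTI.
Qed.

Lemma measurable_cons_rV N : measurable_fun setT (@cons_rV N).
Proof.
apply/measurable_fun_rVP => i.
have [j ->|->] := unliftP ord0 i.
- under eq_fun do rewrite cons_rVS.
  exact: (measurableT_comp (measurable_coord_rV j) measurable_snd).
- by under eq_fun do rewrite cons_rV0; exact: measurable_fst.
Qed.

(* The library instance making products of sigma-finite measures sigma-finite
   is hidden by the one for subprobabilities, hence the direct proof below. *)
Section cons_leb.
Variables (N : nat) (mu : {sigma_finite_measure set 'rV[R]_N -> \bar R}).

Definition cons_leb : set 'rV[R]_N.+1 -> \bar R :=
  pushforward (lebesgue_measure \x mu)%E (@cons_rV N).

Let cons_leb0 : cons_leb set0 = 0%E.
Proof. by rewrite /cons_leb /pushforward preimage_set0 measure0. Qed.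

Let cons_leb_ge0 A : (0 <= cons_leb A)%E.
Proof. exact: (@measure_ge0 _ _ _ (lebesgue_measure \x mu)%E). Qed.

Let cons_leb_sigma_additive : semi_sigma_additive cons_leb.
Proof.
apply: (@measure_semi_sigma_additive _ _ _
  (pushforward (lebesgue_measure \x mu)%E (@cons_rV N))).
exact: measurable_cons_rV.
Qed.

HB.instance Definition _ := isMeasure.Build _ _ _ cons_leb
  cons_leb0 cons_leb_ge0 cons_leb_sigma_additive.

Let cons_leb_sigma_finite : sigma_finite setT cons_leb.
Proof.
have /sigma_finiteP[F [TF ndF Foo]] := sigma_finiteT (@lebesgue_measure R).
have /sigma_finiteP[G [TG ndG Goo]] := sigma_finiteT mu.
pose uncons (x : 'rV[R]_N.+1) : measurableTypeR R * 'rV[R]_N :=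
  (x 0 ord0, \row_i x 0 (lift ord0 i)).
exists (fun k => uncons @^-1` (F k `*` G k)).
  rewrite -preimage_bigcup (_ : \bigcup_k _ = setT) ?preimage_setT//.
  rewrite -setXTT TF TG predeqE => -[x y]; split=> [[n _ []/= ? ?]|].
    by split; exists n.
  move=> [/= [n _ Fnx] [k _ Gky]]; exists (maxn n k) => //; split.
  - by move: x Fnx; exact/subsetPset/ndF/leq_maxl.
  - by move: y Gky; exact/subsetPset/ndG/leq_maxr.
move=> k; have [mF Fk] := Foo k; have [mG Gk] := Goo k.
have mFG : measurable (F k `*` G k) by exact: measurableX.
split.
  rewrite -[X in measurable X]setTI.
  have muncons : measurable_fun setT uncons.
    apply/measurable_fun_pairP; split; first exact: measurable_coord_rV.
    apply/measurable_fun_rVP => i; under eq_fun do rewrite mxE.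
    exact: measurable_coord_rV.
  exact: muncons.
rewrite /cons_leb /pushforward (_ : _ @^-1` _ = F k `*` G k).
  by rewrite product_measure1E// lte_mul_pinfty// ge0_fin_numE.
rewrite -comp_preimage (_ : uncons \o @cons_rV N = id) ?preimage_id//.
apply/funext => -[a v]; rewrite /uncons /= cons_rV0; congr pair.
by apply/rowP => i; rewrite mxE cons_rVS.
Qed.

HB.instance Definition _ := @Measure_isSigmaFinite.Build _ _ _ cons_leb
  cons_leb_sigma_finite.

End cons_leb.

Lemma lebesgue_rV_sigma_finite_measure N :
  exists mu : {sigma_finite_measure set 'rV[R]_N -> \bar R},
    @lebesgue_rV N = mu.
Proof.
elim: N => [|N [mu muE]]; first by exists (\d_(0 : 'rV[R]_0)).
by exists (cons_leb mu); rewrite /= muE.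
Qed.

Section lebesgue_rV_measure.
Variable N : nat.

Let lebesgue_rV0 : @lebesgue_rV N set0 = 0%E.
Proof.
by have [mu ->] := lebesgue_rV_sigma_finite_measure N; exact: measure0.
Qed.

Let lebesgue_rV_ge0 A : (0 <= @lebesgue_rV N A)%E.
Proof.
by have [mu ->] := lebesgue_rV_sigma_finite_measure N; exact: measure_ge0.
Qed.

Let lebesgue_rV_sigma_additive : semi_sigma_additive (@lebesgue_rV N).
Proof.
have [mu ->] := lebesgue_rV_sigma_finite_measure N.
exact: measure_semi_sigma_additive.
Qed.

HB.instance Definition _ := isMeasure.Build _ _ _ (@lebesgue_rV N)
  lebesgue_rV0 lebesgue_rV_ge0 lebesgue_rV_sigma_additive.

Let lebesgue_rV_sigma_finite : sigma_finite setT (@lebesgue_rV N).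
Proof.
by have [mu ->] := lebesgue_rV_sigma_finite_measure N; exact: sigma_finiteT.
Qed.

HB.instance Definition _ := @Measure_isSigmaFinite.Build _ _ _ (@lebesgue_rV N)
  lebesgue_rV_sigma_finite.

End lebesgue_rV_measure.

Lemma lebesgue_rV_box N (A : 'I_N -> set (measurableTypeR R)) :
  (forall i, measurable (A i)) ->
  lebesgue_rV [set x : 'rV[R]_N | forall i, A i (x 0 i)] =
  (\prod_(i < N) lebesgue_measure (A i))%E.
Proof.
elim: N A => [|N IH] A mA.
  rewrite big_ord0 /= diracE (_ : (_ \in _) = true)//.
  by apply/mem_set => -[].
rewrite big_ord_recl /= /pushforward.
have mB : measurable [set x : 'rV[R]_N | forall i, A (lift ord0 i) (x 0 i)].
  rewrite (_ : [set _ | _] = \bigcap_(i in [set: 'I_N])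
    ((fun x : 'rV[R]_N => x 0 i : measurableTypeR R) @^-1` A (lift ord0 i))).
    apply: fin_bigcap_measurable => // i _.
    by rewrite -[X in measurable X]setTI; exact: measurable_coord_rV.
  by apply/seteqP; split=> x /= xA i; [move=> _|]; exact: xA.
rewrite (_ : _ @^-1` _ =
  A ord0 `*` [set x : 'rV[R]_N | forall i, A (lift ord0 i) (x 0 i)]); last first.
  apply/seteqP; split=> -[a v] /=.
    move=> vA; split=> [|i]; first by have := vA ord0; rewrite cons_rV0.
    by have := vA (lift ord0 i); rewrite cons_rVS.
  move=> [a0 vA] i; have [j ->|->] := unliftP ord0 i.
    by rewrite cons_rVS; exact: vA.
  by rewrite cons_rV0.
rewrite product_measure1E//; congr (_ * _)%E.
by rewrite -(IH (fun i => A (lift ord0 i))).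
Qed.

End lebesgue_rV.

Section schwartz.
Context {R : realType} (N : nat).
Implicit Types (g : 'rV[R]_N -> R) (f : 'rV[R]_N -> R[i]).

Definition partial (i : 'I_N) g : 'rV[R]_N -> R :=
  fun x => 'D_(delta_mx 0 i) g x.

Definition iter_partial (w : seq 'I_N) g : 'rV[R]_N -> R := foldr partial g w.

(* C^infinity: the iterated partial derivatives of all orders, in any order of
   differentiation, exist and are continuous. *)
Definition smooth g := forall w : seq 'I_N,
  continuous (iter_partial w g) /\
  forall i x, derivable (iter_partial w g) x (delta_mx 0 i).

Definition monomial (a : 'I_N -> nat) (x : 'rV[R]_N) : R :=
  \prod_(i < N) x 0 i ^+ a i.

Definition multi_partial (b : 'I_N -> nat) g : 'rV[R]_N -> R :=
  iter_partial (flatten [seq nseq (b i) i | i <- enum 'I_N]) g.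

Definition real_schwartz g :=
  smooth g /\
  forall a b : 'I_N -> nat,
    exists M : R, forall x, `|monomial a x * multi_partial b g x| <= M.

(* R[i] is not a normed module over R in the library, so the derivatives of a
   complex-valued function are those of its real and imaginary parts. *)
Definition schwartz f :=
  real_schwartz (fun x => complex.Re (f x)) /\
  real_schwartz (fun x => complex.Im (f x)).

End schwartz.

Section seminorms.
Context {R : realType} (N : nat).
Implicit Types (f : 'rV[R]_N -> R[i]).

(* Euclidean norm: the library norm on 'rV[R]_N is the sup norm. *)
Definition enorm (x : 'rV[R]_N) : R := Num.sqrt (\sum_(i < N) x 0 i ^+ 2).

Definition cmod (z : R[i]) : R := Normc.normc z.

Definition L2_norm f : \bar R :=
  'N[@lebesgue_rV R N]_(2%:E) [ (EFin \o cmod \o f) ]%E.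

(* At x = y the integrand is 0 / 0 = 0; the diagonal is a null set. *)
Definition gagliardo_seminorm (s p : R) f : \bar R :=
  ((\int[@lebesgue_rV R N]_y \int[@lebesgue_rV R N]_x
     ((cmod (f x - f y)) `^ p / (enorm (x - y)) `^ (N%:R + s * p))%:E)
   `^ p^-1)%E.

End seminorms.

(* Main.v *)
(* With Phi(h) = ||f(. + h) - f||_2^2, translation invariance and Tonelli turn
   [f]_{s,2}^2 into the integral of |h|^-(N+2s) Phi(h). Far from the origin,
   Phi <= 4 ||f||_2^2 and s times the integral of |h|^-(N+2s) stays bounded.
   Near the origin, split into dyadic shells: Phi(2h) <= 4 Phi(h) makes
   b_k = 2^(k(N+2)) \int_{2^-(k+1) < |h| <= 2^-k} Phi nondecreasing, and the
   integral with exponent s is comparable to the sum of the q^k b_k with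
   q = 4^-(1-s). As 1 - q is comparable to 1 - s, the normalised quantity is a
   geometric average of b, which increases with q, hence with s. *)
Require Import Defs.
From HB Require Import structures.
From mathcomp Require Import all_boot all_order all_algebra.
From mathcomp Require Import all_classical all_reals all_analysis.
From mathcomp.real_closed Require Import complex.
From mathcomp Require Import measurable_realfun ring lra.

Set Implicit Arguments.
Unset Strict Implicit.
Unset Printing Implicit Defensive.

Import Order.TTheory GRing.Theory Num.Theory.
Import numFieldTopology.Exports numFieldNormedType.Exports.

Local Open Scope classical_set_scope.
Local Open Scope ring_scope.

(** * Affine change of variables for Lebesgue measure *)

Section lebesgue_affine.
Context {R : realType}.
Local Open Scope ereal_scope.

(** By uniqueness of Lebesgue measure: the preimage of []u, v]] under [x |-> c * x + b] is a
    half-open interval of length [(v - u) / c], so [c] times the pushforward agrees with Lebesgue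
    measure on such intervals. *)
Lemma ge0_integral_lebesgue_affine (c b : R) (g : R -> \bar R) :
  (0 < c)%R -> measurable_fun [set: _] g -> (forall x, 0 <= g x) ->
  \int[lebesgue_measure]_x g x = c%:E * \int[lebesgue_measure]_x g (c * x + b)%R.
Proof.
move=> c0 mg g0.
pose phi (x : measurableTypeR R) : measurableTypeR R := (c * x + b)%R.
have mphi : measurable_fun setT phi.
  apply: continuous_measurable_fun => x.
  by apply: cvgD; [exact: mulrl_continuous|exact: cvg_cst].
pose phim : {mfun _ >-> _} :=
  HB.pack phi (isMeasurableFun.Build _ _ _ _ phi mphi).
rewrite -[X in _ * X](@ge0_integral_pushforward _ _ _ _ _ phi mphi
  lebesgue_measure setT g)//.
pose k := NngNum (ltW c0).
rewrite -[c]/(k%:num) -(@ge0_integral_mscale _ _ _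
  (pushforward lebesgue_measure phim) setT measurableT k g)//.
apply: eq_measure_integral => A mA _.
apply: (@lebesgue_measure_unique _ (mscale k (pushforward lebesgue_measure phim))) => //.
move=> _ [[u v]] _ <-.
rewrite /= /mscale /= /pushforward.
have -> : phim @^-1` `]u, v]%classic = `]((u - b) / c)%R, ((v - b) / c)%R]%classic.
  apply/seteqP; split=> x /=; rewrite !in_itv/= /phi.
    move=> /andP[xu xv].
    by rewrite ltr_pdivrMr// ler_pdivlMr//; apply/andP; split; lra.
  by rewrite ltr_pdivrMr// ler_pdivlMr// => /andP[xu xv]; apply/andP; split; lra.
rewrite !lebesgue_measure_itv/= !lte_fin ltr_pM2r ?invr_gt0// ltrD2r.
case: ifPn => _; last by rewrite mule0.
by rewrite -EFinB -EFinM; congr EFin; field; rewrite gt_eqF.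
Qed.

Lemma integral_lebesgue_rVS N (g : 'rV[R]_N.+1 -> \bar R) :
  measurable_fun setT g -> (forall x, 0 <= g x) ->
  \int[@lebesgue_rV R N.+1]_x g x =
  \int[lebesgue_measure]_a \int[@lebesgue_rV R N]_v g (cons_rV (a, v)).
Proof.
move=> mg g0.
transitivity (\int[pushforward (lebesgue_measure \x @lebesgue_rV R N) (@cons_rV R N)]_x g x).
  by [].
rewrite ge0_integral_pushforward//; last exact: measurable_cons_rV.
rewrite preimage_setT fubini_tonelli1//=.
by apply: (measurableT_comp mg); exact: measurable_cons_rV.
Qed.

Lemma measurable_affine_rV N (c : R) (b : 'rV[R]_N) :
  measurable_fun setT (fun x : 'rV[R]_N => (c *: x + b)%R).
Proof.
apply/measurable_fun_rVP => i.
under eq_fun do rewrite !mxE.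
apply: measurable_funD => //.
apply: measurable_funM => //.
exact: measurable_coord_rV.
Qed.

(** Induction on the dimension: Tonelli peels off the first coordinate, and each coordinate
    contributes one factor [c]. Used with [c = 1] for translations and with [c = 2] to pass from one
    dyadic shell to the next. *)
Lemma ge0_integral_rV_affine N (c : R) (b : 'rV[R]_N) (g : 'rV[R]_N -> \bar R) :
  (0 < c)%R -> measurable_fun [set: _] g -> (forall x, 0 <= g x) ->
  \int[@lebesgue_rV R N]_x g x = (c ^+ N)%:E * \int[@lebesgue_rV R N]_x g (c *: x + b)%R.
Proof.
move=> c0; elim: N b g => [|N IH] b g mg g0.
  rewrite expr0 mul1e; apply: eq_integral => x _.
  by congr (g _); apply/rowP => -[].
rewrite integral_lebesgue_rVS// [in RHS]integral_lebesgue_rVS//; last first.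
  by apply: (measurableT_comp mg); exact: measurable_affine_rV.
pose b' : 'rV[R]_N := \row_i b 0%R (lift ord0 i).
have E a v : (c *: cons_rV (a, v) + b)%R = cons_rV (c * a + b 0%R ord0, c *: v + b')%R.
  apply/rowP => i; rewrite !mxE.
  by case: unliftP => [j ->|->]/=; rewrite ?mxE.
under [in RHS]eq_integral do under eq_integral do rewrite E.
have mgc : measurable_fun setT (g \o @cons_rV R N).
  by apply: (measurableT_comp mg); exact: measurable_cons_rV.
have mF : measurable_fun setT (fun a : measurableTypeR R =>
    \int[@lebesgue_rV R N]_v g (cons_rV (a, v))).
  exact: (@measurable_fun_fubini_tonelli_F _ _ _ _ _ (@lebesgue_rV R N) _
    mgc (fun p => g0 (cons_rV p))).
rewrite (ge0_integral_lebesgue_affine (b 0%R ord0) c0 mF); last first.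
  by move=> x; exact: integral_ge0.
rewrite exprS EFinM -muleA; congr (_ * _).
have mpair : measurable_fun setT (fun p : measurableTypeR R * 'rV[R]_N =>
    ((c * p.1 + b 0%R ord0)%R : measurableTypeR R, (c *: p.2 + b')%R)).
  apply/measurable_fun_pairP; split => /=.
    by apply: measurable_funD => //; apply: measurable_funM => //; exact: measurable_fst.
  exact: (measurableT_comp (measurable_affine_rV c b') measurable_snd).
have mF2 : measurable_fun setT (fun a : measurableTypeR R =>
   \int[@lebesgue_rV R N]_v g (cons_rV ((c * a + b 0%R ord0)%R, (c *: v + b')%R))).
  apply: (@measurable_fun_fubini_tonelli_F _ _ _ _ _ (@lebesgue_rV R N)
    (fun p : measurableTypeR R * 'rV[R]_N =>
      g (cons_rV ((c * p.1 + b 0%R ord0)%R, (c *: p.2 + b')%R)))) => //.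
  exact: (measurableT_comp mgc mpair).
rewrite -ge0_integralZl//; last 2 first.
- by move=> x _; exact: integral_ge0.
- by rewrite lee_fin exprn_ge0// ltW.
apply: eq_integral => a _.
apply: (IH b' (fun v => g (cons_rV ((c * a + b 0%R ord0)%R, v)))) => //.
exact: measurableT_comp mgc (pair1_measurable _).
Qed.

End lebesgue_affine.

(** * Borel measurability of continuous functions *)

Section continuous_measurable.
Context {R : realType} (N : nat).

(** The sigma-algebra is generated by the coordinates, so boxes are measurable; an open set is the
    union of the countably many boxes with rational centre and radius [1 / (k + 1)] that it
    contains. *)
Lemma open_measurable_rV (U : set 'rV[R]_N) : open U -> measurable U.
Proof.
move=> oU.
pose box (p : 'rV[rat]_N * nat) : set 'rV[R]_N :=
  [set x | forall i, `|x 0 i - ratr (p.1 0 i)| < p.2.+1%:R^-1].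
have mbox p : measurable (box p).
  rewrite (_ : box p = \bigcap_(i in [set: 'I_N])
    ((fun x : 'rV[R]_N => x 0 i : measurableTypeR R) @^-1`
      ball (ratr (p.1 0 i) : R) (p.2.+1%:R^-1))).
    apply: fin_bigcap_measurable => // i _.
    rewrite -[X in measurable X]setTI; apply: measurable_coord_rV => //.
    exact: measurable_ball.
  apply/seteqP; split=> x /= xA i; first by move=> _; rewrite /ball/= distrC.
  by have := xA i I; rewrite /ball/= distrC.
rewrite (_ : U = \bigcup_p (if `[< box p `<=` U >] then box p else set0)).
  apply: countable_bigcupT_measurable => // p.
  by case: ifP.
apply/seteqP; split=> [x Ux|x [p _]]; last by case: asboolP => // + bx; exact.
have [e /= e0 xeU] := (nbhs_ballP x U).1 (open_nbhs_nbhs (conj oU Ux)).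
(* Radius below [e / 2]: both [x] and any other point of the box lie within one radius of its
   centre, hence within [e] of each other. *)
have [k _ ke] := near_infty_natSinv_lt (PosNum (divr_gt0 e0 (ltr0n _ 2))).
have {}ke : k.+1%:R^-1 < e / 2 := ke k (leqnn k).
have /choice[q qE] (i : 'I_N) : exists q : rat, `|x 0 i - ratr q| < k.+1%:R^-1.
  have : (0:R) < k.+1%:R^-1 by rewrite invr_gt0.
  move: (k.+1%:R^-1) => d d0.
  have lt : x 0 i - d < x 0 i + d by lra.
  have [q] := rat_in_itvoo lt; rewrite in_itv/= => /andP[xq qx].
  by exists q; rewrite ltr_norml; apply/andP; split; lra.
exists (\row_i q i, k) => //.
case: asboolP => [_ i|]; first by rewrite mxE; exact: qE.
case=> y by_; apply: xeU; split=> [//|i j]; rewrite ord1.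
have := by_ j; have := qE j; rewrite /= mxE /ball/= => h1 h2.
rewrite (_ : x 0 j - y 0 j = (x 0 j - ratr (q j)) - (y 0 j - ratr (q j)))//; last by ring.
apply: le_lt_trans (ler_normB _ _) _.
rewrite [e]splitr; apply: ltrD; exact: lt_trans ke.
Qed.

Lemma continuous_measurable_rV (g : 'rV[R]_N -> R) : continuous g ->
  measurable_fun setT g.
Proof.
move=> /continuousP cg.
apply: (measurability _ (RGenOpens.measurableE R)).
move=> _ [_ [a [b ->] <-]]; rewrite setTI; apply: open_measurable_rV; apply: cg.
exact: interval_open.
Qed.

End continuous_measurable.

(** * Geometric averages and their ratios *)

Section geometric.
Context {R : realType}.
Implicit Types (q r : R).

Lemma nneseries_geometric r : 0 <= r -> r < 1 ->
  (\sum_(0 <= k <oo) (r ^+ k)%:E = ((1 - r)^-1)%:E)%E.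
Proof.
move=> r0 r1; apply/cvg_lim => //.
rewrite (_ : (fun _ => _) = EFin \o series (geometric 1 r)); last first.
  apply/funext => n /=; rewrite sumEFin; congr EFin.
  by apply: eq_bigr => i _; rewrite /geometric/= mul1r.
apply: cvg_EFin; first exact: nearW.
rewrite -[(1 - r)^-1]mul1r; apply: cvg_geometric_series.
by rewrite ger0_norm.
Qed.

(** The weights [(1 - q) * q ^+ k] form a probability distribution on the naturals whose mass moves
    to larger [k] as [q] grows, so the average of a nondecreasing sequence grows too. The proof
    compares truncated sums. *)
Lemma geometric_mean_mono q r (b : (\bar R)^nat) : 0 < q -> q <= r -> r < 1 ->
  (forall k, 0 <= b k)%E -> (forall k, b k <= b k.+1)%E ->
  ((1 - q)%:E * \sum_(0 <= k <oo) (q ^+ k)%:E * b k <=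
   (1 - r)%:E * \sum_(0 <= k <oo) (r ^+ k)%:E * b k)%E.
Proof.
move=> q0 qr r1 b0 bS.
have r0 : 0 < r := lt_le_trans q0 qr.
have q1 : q < 1 := le_lt_trans qr r1.
have rb0 k : (0 <= (r ^+ k)%:E * b k)%E by rewrite mule_ge0// lee_fin exprn_ge0// ltW.
have qb0 k : (0 <= (q ^+ k)%:E * b k)%E by rewrite mule_ge0// lee_fin exprn_ge0// ltW.
(* One infinite term makes the right-hand side infinite, since [r > 0]; otherwise the computation
   takes place in the reals. *)
have [[k bk]|bfin] := pselect (exists k, b k = +oo%E).
  rewrite [X in (_ <= _ * X)%E](nneseries_pinfty (k := k))//.
    by rewrite gt0_muley ?leey// lte_fin subr_gt0.
  by rewrite bk gt0_muley// lte_fin exprn_gt0.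
pose c k := fine (b k).
have bE k : b k = (c k)%:E.
  by rewrite /c fineK// ge0_fin_numE// ltey; apply/eqP => bk; apply: bfin; exists k.
have c0 k : 0 <= c k by rewrite -lee_fin -bE.
have cS k : c k <= c k.+1 by rewrite -lee_fin -!bE.
have cmono m n : (m <= n)%N -> c m <= c n.
  by move=> mn; apply: (homo_leq (r := <=%R)) mn => //; exact: le_trans.
(* Summation by parts: [P n x] equals
   [c 0 + \sum_(0 < j <= n) x ^+ j * (c j - c j.-1)], which increases with [x]. *)
pose P n x := (1 - x) * (\sum_(0 <= k < n) x ^+ k * c k) + x ^+ n * c n.
have Pqr n : P n q <= P n r.
  elim: n => [|n IH]; first by rewrite /P !big_nil !mulr0 !expr0.
  have PS x : P n.+1 x = P n x + x ^+ n.+1 * (c n.+1 - c n).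
    by rewrite /P big_nat_recr//= exprS; ring.
  rewrite !PS lerD// ler_wpM2r ?subr_ge0//.
  by rewrite lerXn2r// nnegrE ltW.
(* As [b] is nondecreasing, the tail from [n] on is at least [r ^+ n * c n / (1 - r)]; multiplied by
   [1 - r], it covers the boundary term of [P n r]. *)
have limr n : ((P n r)%:E <= (1 - r)%:E * \sum_(0 <= k <oo) (r ^+ k)%:E * b k)%E.
  rewrite (@nneseries_split _ _ 0%N n)//= add0n.
  rewrite ge0_muleDr; last 2 first.
  - exact: sume_ge0.
  - exact: nneseries_ge0.
  rewrite /P EFinD; apply: leeD.
    by under [in leRHS]eq_bigr do rewrite bE -EFinM; rewrite sumEFin.
  rewrite -nneseries_addn//.
  apply: (@le_trans _ _ ((1 - r)%:E * \sum_(0 <= k <oo) ((r ^+ n * c n)%:E * (r ^+ k)%:E))%E).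
    rewrite nneseriesZl; last by move=> i _; rewrite lee_fin exprn_ge0// ltW.
    rewrite nneseries_geometric//; last exact: ltW.
    rewrite -!EFinM lee_fin.
    by rewrite mulrCA mulfV ?mulr1// subr_eq0 gt_eqF.
  apply: lee_wpmul2l; first by rewrite lee_fin subr_ge0 ltW.
  apply: lee_nneseries => [i _ _|i _].
    by rewrite -EFinM lee_fin !mulr_ge0// exprn_ge0// ltW.
  rewrite bE -!EFinM lee_fin mulrAC -exprD addnC ler_wpM2l//.
    by rewrite exprn_ge0// ltW.
  by rewrite cmono// leq_addl.
rewrite -nneseriesZl; last by move=> i _; exact: qb0.
apply: lime_le.
  by apply: is_cvg_nneseries => i _ _; rewrite mule_ge0// lee_fin subr_ge0 ltW.
(* The [n]-th partial sum is at most [P n q], whose boundary term is nonnegative. *)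
apply: nearW => n; apply: le_trans (limr n).
apply: le_trans (_ : (P n q)%:E <= _)%E; last first.
  by rewrite lee_fin.
under eq_bigr do rewrite bE -!EFinM.
by rewrite sumEFin -mulr_sumr lee_fin /P lerDl mulr_ge0// exprn_ge0// ltW.

Qed.

Lemma one_sub_powR4_le (d : R) : 1 - 4 `^ (- d) <= d * ln 4.
Proof.
rewrite /powR ifF; last by apply/negbTE; rewrite pnatr_eq0.
by have := expR_ge1Dx (- d * ln (4:R)); lra.
Qed.

(** With [y = d * ln 4], the bound [expR y >= 1 + y] gives [1 - expR (- y) >= y / (1 + y)], and
    [y <= ln 4] because [d <= 1]. *)
Lemma one_sub_powR4_ge (d : R) : 0 <= d -> d <= 1 ->
   d * ln 4 <= (1 + ln 4) * (1 - 4 `^ (- d)).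
Proof.
move=> d0 d1.
have l0 : (0:R) <= ln 4 by rewrite ln_ge0// ler1n.
rewrite /powR ifF; last by apply/negbTE; rewrite pnatr_eq0.
rewrite mulNr.
set y := d * ln 4.
have y0 : 0 <= y by rewrite mulr_ge0.
have yl : y <= ln 4 by rewrite ler_piMl.
have := expR_ge1Dx y; rewrite expRN.
have : 0 < expR y by exact: expR_gt0.
move: (expR y) (ln 4) l0 yl => z l l0 yl z0 hz.
have zi : z^-1 <= (1 + y)^-1 by rewrite lef_pV2// posrE; lra.
apply: (@le_trans _ _ ((1 + l) * (1 - (1 + y)^-1))); last first.
  by rewrite ler_wpM2l//; lra.
rewrite (_ : 1 - (1 + y)^-1 = y / (1 + y)); last by field; lra.
rewrite mulrA ler_pdivlMr; last lra.
by rewrite mulrC ler_wpM2r//; lra.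
Qed.

End geometric.

(** * Complex modulus and Euclidean norm *)

Section complex_modulus.
Context {R : realType}.
Implicit Types z w : R[i].

Lemma cmod_sqE z : cmod z ^+ 2 = complex.Re z ^+ 2 + complex.Im z ^+ 2.
Proof. by case: z => a b; rewrite /cmod /= sqr_sqrtr// addr_ge0// sqr_ge0. Qed.

Lemma cmod_ge0 z : 0 <= cmod z.
Proof. by case: z => a b; rewrite /cmod /= sqrtr_ge0. Qed.

Lemma cmodN z : cmod (- z) = cmod z.
Proof. exact: normcN. Qed.

(** Parallelogram law: the two sides differ by the squared modulus of [z - w]. *)
Lemma cmod_sqD_le z w : cmod (z + w) ^+ 2 <= 2 * cmod z ^+ 2 + 2 * cmod w ^+ 2.
Proof.
rewrite !cmod_sqE; case: z w => [a b] [c d] /=.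
have := sqr_ge0 (a - c); have := sqr_ge0 (b - d).
by rewrite !expr2; lra.
Qed.

Lemma measurable_cmod_sqB d (T : measurableType d) (f g : T -> R[i]) :
  measurable_fun setT (fun x => complex.Re (f x)) ->
  measurable_fun setT (fun x => complex.Im (f x)) ->
  measurable_fun setT (fun x => complex.Re (g x)) ->
  measurable_fun setT (fun x => complex.Im (g x)) ->
  measurable_fun setT (fun x => cmod (f x - g x) ^+ 2).
Proof.
move=> mRf mIf mRg mIg; rewrite (_ : (fun _ => _) =
    (fun x => (complex.Re (f x) - complex.Re (g x)) ^+ 2 +
              (complex.Im (f x) - complex.Im (g x)) ^+ 2)); last first.
  by apply/funext => x; rewrite cmod_sqE /=; case: (f x) (g x) => ? ? [].
by apply: measurable_funD; apply: measurable_funX; apply: measurable_funB.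
Qed.

Lemma measurable_cmod_sq d (T : measurableType d) (f : T -> R[i]) :
  measurable_fun setT (fun x => complex.Re (f x)) ->
  measurable_fun setT (fun x => complex.Im (f x)) ->
  measurable_fun setT (fun x => cmod (f x) ^+ 2).
Proof.
move=> mRf mIf; under eq_fun do rewrite cmod_sqE.
by apply: measurable_funD; exact: measurable_funX.
Qed.

End complex_modulus.

Section euclidean_norm.
Context {R : realType} (N : nat).
Implicit Types x : 'rV[R]_N.

Lemma enorm_ge0 x : 0 <= enorm x.
Proof. exact: sqrtr_ge0. Qed.

Lemma enormZ (c : R) x : 0 <= c -> enorm (c *: x) = c * enorm x.
Proof.
move=> c0; rewrite /enorm (eq_bigr (fun i => c ^+ 2 * x 0 i ^+ 2)).
  by rewrite -mulr_sumr sqrtrM ?sqr_ge0// sqrtr_sqr ger0_norm.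
by move=> i _; rewrite mxE exprMn.
Qed.

Lemma normr_coord_le_enorm x i : `|x 0 i| <= enorm x.
Proof.
rewrite -sqrtr_sqr /enorm ler_wsqrtr// (bigD1 i)//= lerDl sumr_ge0// => j _.
exact: sqr_ge0.
Qed.

Lemma measurable_enorm : measurable_fun setT (@enorm R N).
Proof.
have ms : measurable_fun setT (@Num.sqrt R).
  by apply: continuous_measurable_fun; exact: sqrt_continuous.
apply: (measurableT_comp ms); apply: measurable_sum => i; apply: measurable_funX.
exact: measurable_coord_rV.
Qed.

End euclidean_norm.

(** * Mean square of the increments of a function *)

Section square_difference.
Context {R : realType} (N : nat).
Local Notation mu := (@lebesgue_rV R N).
Variable f : 'rV[R]_N -> R[i].
Hypothesis mRe : measurable_fun setT (fun x => complex.Re (f x)).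
Hypothesis mIm : measurable_fun setT (fun x => complex.Im (f x)).

(** The function Phi of the overview. *)
Definition square_difference (h : 'rV[R]_N) : \bar R :=
  (\int[mu]_y (cmod (f (y + h) - f y) ^+ 2)%:E)%E.

Lemma measurable_add_rV : measurable_fun setT (fun p : 'rV[R]_N * 'rV[R]_N => p.2 + p.1).
Proof.
apply/measurable_fun_rVP => i; under eq_fun do rewrite mxE.
apply: measurable_funD.
  exact: (measurableT_comp (measurable_coord_rV i) measurable_snd).
exact: (measurableT_comp (measurable_coord_rV i) measurable_fst).
Qed.

Lemma measurable_increment : measurable_fun setT
  (fun p : 'rV[R]_N * 'rV[R]_N => (cmod (f (p.2 + p.1) - f p.2) ^+ 2)%:E).
Proof.
apply/measurable_EFinP.
apply: (measurable_cmod_sqB (f := fun p : 'rV[R]_N * 'rV[R]_N => f (p.2 + p.1))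
                            (g := fun p => f p.2)).
- exact: (measurableT_comp mRe measurable_add_rV).
- exact: (measurableT_comp mIm measurable_add_rV).
- exact: (measurableT_comp mRe measurable_snd).
- exact: (measurableT_comp mIm measurable_snd).
Qed.

Lemma square_difference_ge0 h : (0 <= square_difference h)%E.
Proof. by apply: integral_ge0 => y _; rewrite lee_fin sqr_ge0. Qed.

Lemma measurable_square_difference : measurable_fun setT square_difference.
Proof.
apply: (measurable_fun_fubini_tonelli_F (m2 := mu) _ measurable_increment).
by move=> p; rewrite lee_fin sqr_ge0.
Qed.

Lemma integral_translation (b : 'rV[R]_N) (g : 'rV[R]_N -> \bar R) :
  measurable_fun setT g -> (forall x, 0 <= g x)%E ->
  (\int[mu]_x g x = \int[mu]_x g (x + b)%R)%E.
Proof.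
move=> mg g0; rewrite (ge0_integral_rV_affine (c := 1) b)// expr1n mul1e.
by apply: eq_integral => x _; rewrite scale1r.
Qed.

Lemma measurable_shift (b : 'rV[R]_N) : measurable_fun setT (fun x : 'rV[R]_N => x + b).
Proof.
have := measurable_affine_rV 1 b.
by under eq_fun do rewrite scale1r.
Qed.

(** [cmod_sqD_le] under the integral gives twice the squared norm of a translate of [f] plus twice
    that of [f]; translation invariance makes the two equal. *)
Lemma square_difference_le_L2 h :
  (square_difference h <= 4%:E * \int[mu]_x (cmod (f x) ^+ 2)%:E)%E.
Proof.
have m0 : measurable_fun setT (fun x : 'rV[R]_N => (cmod (f x) ^+ 2)%:E).
  by apply/measurable_EFinP; exact: measurable_cmod_sq.
have m1 : measurable_fun setT (fun x : 'rV[R]_N => (cmod (f (x + h)) ^+ 2)%:E).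
  exact: (measurableT_comp m0 (measurable_shift h)).
have s0 (x : R) : (0 <= (x ^+ 2)%:E)%E by rewrite lee_fin sqr_ge0.
apply: (@le_trans _ _ (\int[mu]_x (2%:E * (cmod (f (x + h)) ^+ 2)%:E +
   2%:E * (cmod (f x) ^+ 2)%:E))%E).
  apply: ge0_le_integral => //.
  - exact: (measurableT_comp measurable_increment (pair1_measurable h)).
  - by apply: emeasurable_funD; apply: measurable_funeM.
  - move=> x _; rewrite -!EFinM -EFinD lee_fin.
    by rewrite -[cmod (f x)]cmodN; exact: cmod_sqD_le.
rewrite ge0_integralD//; last 4 first.
- by move=> x _; rewrite mule_ge0.
- exact: measurable_funeM.
- by move=> x _; rewrite mule_ge0.
- exact: measurable_funeM.
rewrite !ge0_integralZl//.
rewrite -(integral_translation h (g := fun x => (cmod (f x) ^+ 2)%:E))//.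
rewrite -ge0_muleDl// -EFinD.
by rewrite (_ : (2 + 2 : R) = 4)//; ring.
Qed.

(** The increment by [2 *: h] is the sum of two increments by [h], one a translate of the other;
    each contributes twice [square_difference f h]. *)
Lemma square_difference_double h :
  (square_difference (2 *: h) <= 4%:E * square_difference h)%E.
Proof.
have s0 (x : R) : (0 <= (x ^+ 2)%:E)%E by rewrite lee_fin sqr_ge0.
have m0 : measurable_fun setT (fun x : 'rV[R]_N => (cmod (f (x + h) - f x) ^+ 2)%:E).
  exact: (measurableT_comp measurable_increment (pair1_measurable h)).
have m1 : measurable_fun setT (fun x : 'rV[R]_N =>
    (cmod (f (x + h + h) - f (x + h)) ^+ 2)%:E).
  exact: (measurableT_comp m0 (measurable_shift h)).
apply: (@le_trans _ _ (\int[mu]_x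
  (2%:E * (cmod (f (x + h + h) - f (x + h)) ^+ 2)%:E +
   2%:E * (cmod (f (x + h) - f x) ^+ 2)%:E))%E).
  apply: ge0_le_integral => //.
  - exact: (measurableT_comp measurable_increment (pair1_measurable (2 *: h))).
  - by apply: emeasurable_funD; apply: measurable_funeM.
  - move=> x _; rewrite -!EFinM -EFinD lee_fin scaler_nat mulr2n addrA.
    by rewrite -[f (_ + h + h) - f x](subrKA (f (x + h))); exact: cmod_sqD_le.
rewrite ge0_integralD//; last 4 first.
- by move=> x _; rewrite mule_ge0.
- exact: measurable_funeM.
- by move=> x _; rewrite mule_ge0.
- exact: measurable_funeM.
rewrite !ge0_integralZl//.
rewrite -(integral_translation h (g := fun x => (cmod (f (x + h) - f x) ^+ 2)%:E))//.
rewrite -ge0_muleDl// -EFinD.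
by rewrite (_ : (2 + 2 : R) = 4)//; ring.
Qed.

(** Substitute [x = y + h] in the inner integral, then exchange [y] and [h] by Tonelli. At [h = 0]
    the conventions for inverses and for powers of zero agree. *)
Lemma gagliardo_integralE s :
  (\int[mu]_y \int[mu]_x
     ((cmod (f x - f y)) `^ 2 / (enorm (x - y)) `^ (N%:R + s * 2))%:E =
   \int[mu]_h ((enorm h `^ (- (N%:R + s * 2)))%:E * square_difference h))%E.
Proof.
set a := N%:R + s * 2.
have s0 (x : R) : (0 <= (x ^+ 2)%:E)%E by rewrite lee_fin sqr_ge0.
have mw : measurable_fun setT (fun h : 'rV[R]_N => (enorm h `^ (- a))%:E).
  apply/measurable_EFinP; apply: (measurableT_comp (measurable_powR (- a))).
  exact: measurable_enorm.
have mG : measurable_fun setT (fun p : 'rV[R]_N * 'rV[R]_N =>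
   ((enorm p.1 `^ (- a))%:E * (cmod (f (p.2 + p.1) - f p.2) ^+ 2)%:E)%E).
  apply: emeasurable_funM; last exact: measurable_increment.
  exact: (measurableT_comp mw measurable_fst).
transitivity (\int[mu]_y \int[mu]_h
   ((enorm h `^ (- a))%:E * (cmod (f (y + h) - f y) ^+ 2)%:E))%E.
  apply: eq_integral => y _.
  rewrite (integral_translation y).
  - apply: eq_integral => h _.
    by rewrite addrK powRN -[2]/(2%:R) powR_mulrn ?cmod_ge0// mulrC EFinM (addrC h).
  - under eq_fun do rewrite -[2]/(2%:R) powR_mulrn ?cmod_ge0// -powRN EFinM.
    apply: emeasurable_funM.
      apply/measurable_EFinP.
      exact: (measurable_cmod_sqB (g := fun=> f y)).
    exact: (measurableT_comp mw (measurable_shift (- y))).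
  - by move=> x; rewrite lee_fin mulr_ge0// ?invr_ge0 powR_ge0.
rewrite -(fubini_tonelli _ mG); last by move=> p; rewrite mule_ge0// lee_fin powR_ge0.
apply: eq_integral => h _ /=; rewrite ge0_integralZl//.
- exact: (measurableT_comp measurable_increment (pair1_measurable h)).
- by rewrite lee_fin powR_ge0.
Qed.

End square_difference.

(** * Dyadic brackets and powers of two *)

Section dyadic.
Context {R : realType}.
Implicit Types (x a : R).

Lemma dyadic_bracket x : 1 <= x -> exists k : nat, 2 ^+ k <= x < 2 ^+ k.+1.
Proof.
move=> x1.
have ex : exists k : nat, x < 2 ^+ k.+1.
  exists (Num.bound x); apply: lt_trans (archi_boundP (le_trans ler01 x1)) _.
  by rewrite -natrX ltr_nat; apply: ltn_trans (ltnSn _) (ltn_expl _ _).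
(* For the least exponent, minimality gives the lower bound, except at exponent 0, where it is the
   hypothesis [1 <= x]. *)
exists (ex_minn ex); case: ex_minnP => -[|k] xk mink; first by rewrite expr0 x1.
rewrite xk andbT leNgt; apply/negP => /mink; by rewrite ltnn.
Qed.

Lemma powR_exprn x a k : 0 <= x -> (x ^+ k) `^ a = (x `^ a) ^+ k.
Proof.
move=> x0; rewrite -(powR_mulrn k x0) -(powR_mulrn k (powR_ge0 x a)).
exact: powRAC.
Qed.

Lemma powR_invr x a : (x^-1) `^ a = (x `^ a)^-1.
Proof.
have [x0|x0] := leP 0 x; first by rewrite -powR_inv1// powRAC powR_inv1// powR_ge0.
(* For a negative base [ln] takes its default value 0, so both sides are 1. *)
rewrite /powR ifF ?ifF ?(ln0 (ltW x0)) ?ln0 ?invr_le0 ?(ltW x0)//.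
- by rewrite mulr0 expR0 invr1.
- by rewrite lt_eqF.
- by rewrite invr_eq0 lt_eqF.
Qed.

Lemma powR2_scale (n : nat) (s : R) :
  2 `^ (n%:R + s * 2) = 2 ^+ (n + 2) * 4 `^ (- (1 - s)).
Proof.
rewrite (_ : 4 = 2 `^ 2 :> R); last by rewrite -[2 in RHS]/(2%:R) powR_mulrn//; ring.
rewrite -powRrM -powR_mulrn// -powRD; last by rewrite pnatr_eq0 implybT.
by congr (_ `^ _); rewrite natrD; ring.
Qed.

(** The ratio of the series far from the origin: the weight decays by the first factor per dyadic
    step while the volume grows by the second. *)
Lemma powR2_opp_scale (n : nat) (s : R) :
  (2 `^ (n%:R + s * 2))^-1 * 2 ^+ n = 4 `^ (- s).
Proof.
rewrite (_ : 4 = 2 `^ 2 :> R); last by rewrite -[2 in RHS]/(2%:R) powR_mulrn//; ring.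
rewrite -powRrM -powR_mulrn// -powRN -powRD; last by rewrite pnatr_eq0 implybT.
by congr (_ `^ _); ring.
Qed.

End dyadic.

(** * Dyadic shells and the integral of the weight far from the origin *)

Section dyadic_shell.
Context {R : realType} (N : nat).
Local Notation mu := (@lebesgue_rV R N).

(** Half-open, so that the shells partition the closed unit ball without the origin. *)
Definition shell (k : nat) : set 'rV[R]_N :=
  [set h | 2^-1 ^+ k.+1 < enorm h <= 2^-1 ^+ k].

Lemma measurable_shell k : measurable (shell k).
Proof.
rewrite -[X in measurable X]setTI.
rewrite (_ : shell k = @enorm R N @^-1` `]2^-1 ^+ k.+1, 2^-1 ^+ k]%classic); last first.
  by apply/seteqP; split => x /=; rewrite in_itv.
by apply: measurable_enorm.
Qed.

Lemma trivIset_shell : trivIset setT shell.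
Proof.
apply: ltn_trivIset => n m mn; apply/seteqP; split => // h [] /= /andP[h1 _] /andP[_ h2].
have : (2^-1 : R) ^+ n <= 2^-1 ^+ m.+1 by apply: ler_wiXn2l => //; lra.
by move=> /(le_trans h2)/(lt_le_trans h1); rewrite ltxx.
Qed.

Lemma shellS k (h : 'rV[R]_N) : shell k (2 *: h) <-> shell k.+1 h.
Proof.
rewrite /shell /= enormZ// (exprS _ k.+1) (exprS _ k).
by move: (enorm h) (_ ^+ k) => r y; split=> /andP[? ?]; apply/andP; split; lra.
Qed.

Lemma shell_weight a k h : 0 <= a -> shell k h ->
  (2 `^ a) ^+ k <= enorm h `^ (- a) <= (2 `^ a) ^+ k.+1.
Proof.
move=> a0 /andP[h1 h2].
have p2 n : (0:R) < 2^-1 ^+ n by rewrite exprn_gt0.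
have h0 : 0 < enorm h := lt_trans (p2 _) h1.
have E n : (2 `^ a) ^+ n = ((2^-1 ^+ n) `^ a)^-1.
  by rewrite powR_exprn// powR_invr -exprVn invrK.
have p2W n := ltW (p2 n); have h0W := ltW h0.
rewrite powRN !E !lef_pV2 ?posrE ?powR_gt0//.
by apply/andP; split; rewrite ge0_ler_powR ?nnegrE//; exact: ltW.
Qed.

Lemma setC_bigcup_shell h : (~` \bigcup_k shell k) h -> enorm h = 0 \/ 1 < enorm h.
Proof.
move=> hS; have [h1|h1] := ltP 1 (enorm h); [by right|left].
apply/eqP; rewrite eq_le enorm_ge0 andbT leNgt; apply/negP => h0; apply: hS.
(* The shell containing [h] is read off from the dyadic bracket of the inverse of its norm. *)
have [k /andP[k1 k2]] : exists k : nat, 2 ^+ k <= (enorm h)^-1 < 2 ^+ k.+1.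
  by apply: dyadic_bracket; rewrite invf_ge1.
exists k => //; rewrite /shell /= !exprVn; apply/andP; split.
  by rewrite invf_plt ?posrE// exprn_gt0.
by rewrite -[enorm h]invrK lef_pV2 ?posrE ?invr_gt0// exprn_gt0.
Qed.

(** Cubes serve as outer approximations of Euclidean balls, because their measure is an explicit
    product. *)
Definition box (r : R) : set 'rV[R]_N := [set x | forall i, ball (0 : R) r (x 0 i)].

Lemma measurable_box r : measurable (box r).
Proof.
rewrite (_ : box r = \bigcap_(i in [set: 'I_N])
    ((fun x : 'rV[R]_N => x 0 i : measurableTypeR R) @^-1` ball (0 : R) r)).
  apply: fin_bigcap_measurable => // i _.
  by rewrite -[X in measurable X]setTI; apply: measurable_coord_rV => //; exact: measurable_ball.
by apply/seteqP; split=> x /= xA i; [move=> _|]; exact: xA.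
Qed.

Lemma lebesgue_box r : 0 <= r -> mu (box r) = ((r *+ 2) ^+ N)%:E.
Proof.
move=> r0; rewrite (@lebesgue_rV_box _ _ (fun=> ball (0 : R) r)); last first.
  by move=> _; exact: measurable_ball.
under eq_bigr do rewrite lebesgue_measure_ball//.
by rewrite prodEFin prodr_const card_ord.
Qed.

(** Where [2 ^+ k <= enorm h < 2 ^+ k.+1], the weight is at most [(2]^ a) ^-
    k[and]h[lies in the cube of side]4 * 2 ^+ k[. Summing weight times volume gives]4 ^+
    N[times the geometric series of ratio]4 [^ (- s)]. *)
Lemma far_weight_integral (s : R) : 0 < s ->
  (\int[mu]_(h in ~` \bigcup_k shell k) (enorm h `^ (- (N%:R + s * 2)))%:E <=
   (4 ^+ N / (1 - 4 `^ (- s)))%:E)%E.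
Proof.
move=> s0; set a := N%:R + s * 2.
have a0 : 0 < a by rewrite ltr_wpDl// mulr_gt0.
have mw : measurable_fun setT (fun h : 'rV[R]_N => (enorm h `^ (- a))%:E).
  apply/measurable_EFinP; apply: (measurableT_comp (measurable_powR (- a))).
  exact: measurable_enorm.
have mC : measurable (~` \bigcup_k shell k).
  by apply: measurableC; apply: bigcup_measurable => k _; exact: measurable_shell.
pose g k (h : 'rV[R]_N) := (((2 `^ a) ^- k)%:E * (\1_(box (2 ^+ k.+1)) h)%:E)%E.
have g0 k h : (0 <= g k h)%E by rewrite mule_ge0 // lee_fin ?invr_ge0 ?exprn_ge0 ?powR_ge0.
have mg k : measurable_fun setT (g k).
  apply: measurable_funeM; apply/measurable_EFinP; apply: measurable_indic.
  exact: measurable_box.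
apply: (@le_trans _ _ (\int[mu]_h \sum_(0 <= k <oo) g k h)%E).
  apply: (@le_trans _ _ (\int[mu]_(h in ~` \bigcup_k shell k) \sum_(0 <= k <oo) g k h)%E).
    apply: ge0_le_integral => //.
    - by move=> h _; rewrite lee_fin powR_ge0.
    - exact: measurable_funS mw.
    - apply: (@measurable_funS _ _ _ _ setT) => //.
      by apply: ge0_emeasurable_sum.
    - move=> h /setC_bigcup_shell[->|h1].
        (* The origin lies in no shell; there the weight is 0, the value of [powR] at base 0 and
           nonzero exponent. *)
        by rewrite powR0 ?nneseries_ge0// oppr_eq0 gt_eqF.
      have [k /andP[k1 k2]] := dyadic_bracket (ltW h1).
      apply: (@le_trans _ _ (g k h)); last first.
        by rewrite (@nneseriesD1 _ _ k)// leeDl// nneseries_ge0.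
      rewrite /g indicE mem_set ?mule1; last first.
        move=> i; rewrite /ball /= sub0r normrN.
        exact: le_lt_trans (normr_coord_le_enorm _ _) k2.
      rewrite lee_fin powRN -powR_exprn// lef_pV2 ?posrE ?powR_gt0 ?exprn_gt0//;
        last exact: lt_trans h1.
      by rewrite ge0_ler_powR ?nnegrE ?exprn_ge0// ?enorm_ge0// ltW.
  apply: ge0_subset_integral => //; first exact: ge0_emeasurable_sum.
  by move=> h _; exact: nneseries_ge0.
rewrite integral_nneseries//.
have q0 : (0:R) <= 4 `^ (- s) by exact: powR_ge0.
have q1 : (4:R) `^ (- s) < 1.
  by rewrite /powR pnatr_eq0/= expR_lt1 mulNr oppr_lt0 mulr_gt0// ln_gt0// ltr1n.
rewrite (_ : (\sum_(0 <= k <oo) _)%E =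
    (\sum_(0 <= k <oo) ((4 ^+ N)%:E * ((4 `^ (- s)) ^+ k)%:E))%E).
  rewrite nneseriesZl; last by move=> i _; rewrite lee_fin exprn_ge0.
  by rewrite nneseries_geometric// EFinM.
apply: eq_eseriesr => k _.
rewrite /g ge0_integralZl//; last first.
  by apply/measurable_EFinP; apply: measurable_indic; exact: measurable_box.
rewrite integral_indic//; last exact: measurable_box.
rewrite setIT [X in (_ * X)%E](lebesgue_box (exprn_ge0 _ (ler0n _ 2))).
rewrite -!EFinM -(powR2_opp_scale N s) exprMn.
congr EFin; rewrite exprS (_ : 2 * 2 ^+ k *+ 2 = 4 * 2 ^+ k :> R); last by ring.
by rewrite exprMn exprAC exprVn mulrCA.
Qed.

End dyadic_shell.

Arguments shell {R N}.

(** * Energy near and far from the origin *)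

Section energy.
Context {R : realType} (N : nat).
Local Notation mu := (@lebesgue_rV R N).
Variable f : 'rV[R]_N -> R[i].
Hypothesis mRe : measurable_fun setT (fun x => complex.Re (f x)).
Hypothesis mIm : measurable_fun setT (fun x => complex.Im (f x)).

Local Notation ball0 := (\bigcup_k @shell R N k).
Local Notation L2 := (\int[mu]_x (cmod (f x) ^+ 2)%:E)%E.

(** For [A = setT] this is the squared Gagliardo seminorm. Below, [ball0] is the closed unit ball
    without the origin. *)
Definition energy (A : set 'rV[R]_N) (s : R) : \bar R :=
  (\int[mu]_(h in A) ((enorm h `^ (- (N%:R + s * 2)))%:E * square_difference f h))%E.

Let measurable_ball0 : measurable ball0.
Proof. by apply: bigcup_measurable => k _; exact: measurable_shell. Qed.

Let mw s : measurable_fun setT (fun h : 'rV[R]_N =>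
  (enorm h `^ (- (N%:R + s * 2)))%:E).
Proof.
apply/measurable_EFinP; apply: (measurableT_comp (measurable_powR _)).
exact: measurable_enorm.
Qed.

Let integrand_ge0 s h :
  (0 <= (enorm h `^ (- (N%:R + s * 2)))%:E * square_difference f h)%E.
Proof. by rewrite mule_ge0// ?lee_fin ?powR_ge0//; exact: square_difference_ge0. Qed.

Lemma measurable_energy_integrand s :
  measurable_fun setT (fun h =>
    ((enorm h `^ (- (N%:R + s * 2)))%:E * square_difference f h)%E).
Proof. by apply: emeasurable_funM => //; exact: measurable_square_difference. Qed.

Lemma energy_ge0 A s : (0 <= energy A s)%E.
Proof. by apply: integral_ge0 => h _. Qed.

Lemma energy_le A s : measurable A -> (energy A s <= energy setT s)%E.
Proof. by move=> mA; apply: ge0_subset_integral => //; exact: measurable_energy_integrand. Qed.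

Lemma energy_split s : energy setT s = (energy ball0 s + energy (~` ball0) s)%E.
Proof.
rewrite -ge0_integral_setU ?setUv//; last 3 first.
- exact: measurableC.
- exact: measurable_energy_integrand.
- exact/disj_setPCl.
Qed.

Lemma energy_far s : 0 < s -> s < 1 ->
  (s%:E * energy (~` ball0) s <= (4 ^+ N.+1 * (1 + ln 4) / ln 4)%:E * L2)%E.
Proof.
move=> s0 s1.
have L0 : (0 <= L2)%E by apply: integral_ge0 => x _; rewrite lee_fin sqr_ge0.
have mC : measurable (~` ball0) by exact: measurableC.
have far : (energy (~` ball0) s <= (4 ^+ N / (1 - 4 `^ (- s)))%:E * (4%:E * L2))%E.
  apply: (@le_trans _ _ (\int[mu]_(h in ~` ball0)
      ((enorm h `^ (- (N%:R + s * 2)))%:E * (4%:E * L2)))%E).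
    apply: ge0_le_integral => //.
    - exact: measurable_funS (measurable_energy_integrand s).
    - by apply: emeasurable_funM => //; exact: measurable_funS (mw s).
    - move=> h _; apply: lee_wpmul2l; first by rewrite lee_fin powR_ge0.
      exact: square_difference_le_L2.
  rewrite ge0_integralZr//; last 3 first.
  - exact: measurable_funS (mw s).
  - by move=> h _; rewrite lee_fin powR_ge0.
  - by rewrite mule_ge0.
  apply: lee_wpmul2r; first by rewrite mule_ge0.
  exact: far_weight_integral.
apply: (@le_trans _ _ (s%:E * ((4 ^+ N / (1 - 4 `^ (- s)))%:E * (4%:E * L2)))%E).
  by apply: lee_wpmul2l far; rewrite lee_fin ltW.
rewrite !muleA -!EFinM; apply: (lee_wpmul2r L0); rewrite lee_fin.
have l0 : (0:R) < ln 4 by rewrite ln_gt0// ltr1n.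
have := one_sub_powR4_ge (ltW s0) (ltW s1).
have : 0 < s * ln (4 : R) by rewrite mulr_gt0.
rewrite exprS; move: (4 ^+ N) (exprn_ge0 N (ler0n R 4)) => M M0 sl0.
move: (ln 4) l0 sl0 (1 - 4 `^ (- s)) => l l0 sl0 y hy.
have y0 : 0 < y by move: (lt_le_trans sl0 hy); rewrite pmulr_rgt0// addr_gt0.
rewrite ler_pdivlMr// (_ : s * (M / y) * 4 * l = 4 * M * (s * l / y));
  last by field; rewrite gt_eqF.
by rewrite ler_wpM2l ?mulr_ge0// ler_pdivrMr.
Qed.

Let c k : \bar R := (\int[mu]_(h in shell k) square_difference f h)%E.

Let c_ge0 k : (0 <= c k)%E.
Proof. by apply: integral_ge0 => h _; exact: square_difference_ge0. Qed.

(** Dilation by 2 carries shell [k.+1] onto shell [k] with Jacobian [2 ^+ N]; the doubling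
    inequality contributes the remaining [2 ^+ 2]. *)
Lemma square_difference_shellS k : (c k <= (2 ^+ (N + 2))%:E * c k.+1)%E.
Proof.
have mS := measurable_square_difference mRe mIm.
have mR : measurable_fun setT (square_difference f \_ (shell k)).
  by apply/(measurable_restrictT _ (measurable_shell _)); exact: measurable_funS mS.
rewrite /c integral_mkcond (ge0_integral_rV_affine (c := 2) 0)//; last first.
  by move=> x; apply: erestrict_ge0 => h _; exact: square_difference_ge0.
rewrite exprD EFinM -muleA; apply: lee_wpmul2l; first by rewrite lee_fin exprn_ge0.
rewrite -ge0_integralZl//; last 3 first.
- exact: measurable_shell.
- exact: measurable_funS mS.
- by move=> h _; exact: square_difference_ge0.
rewrite [leRHS]integral_mkcond; apply: ge0_le_integral => //.
- move=> h _; apply: (erestrict_ge0 (f := square_difference f)) => x _.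
  exact: square_difference_ge0.
- exact: (measurableT_comp mR (measurable_affine_rV 2 0)).
- apply/(measurable_restrictT _ (measurable_shell _)); apply: measurable_funeM.
  exact: measurable_funS mS.
move=> h _; rewrite addr0 !patchE.
have [hk|hk] := pselect (shell k.+1 h).
  rewrite !mem_set//; last exact/shellS.
  rewrite (_ : 2 ^+ 2 = 4 :> R); last by ring.
  exact: square_difference_double.
rewrite !memNset//; by move=> /shellS.
Qed.

(** Shell by shell, each energy is compared with a power series in the same nondecreasing sequence
    [b], of ratio [q] for [s] and [r] for [t]; [geometric_mean_mono] then compares the two
    series. *)
Lemma energy_near s t : 0 < s -> s <= t -> t < 1 ->
  ((1 - s)%:E * energy ball0 s <=
   (2 ^+ (N + 2) * (1 + ln 4))%:E * ((1 - t)%:E * energy ball0 t))%E.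
Proof.
move=> s0 st t1.
have t0 := lt_le_trans s0 st; have s1 := le_lt_trans st t1.
set M : R := 2 ^+ (N + 2).
have M0 : 0 < M by rewrite exprn_gt0.
pose q : R := 4 `^ (- (1 - s)); pose r : R := 4 `^ (- (1 - t)).
have q0 : 0 < q by rewrite powR_gt0.
have qr : q <= r by rewrite ler_powR ?ler1n// lerN2 lerB.
have r1 : r < 1.
  by rewrite /r /powR pnatr_eq0/= expR_lt1 mulNr oppr_lt0 mulr_gt0 ?subr_gt0// ln_gt0// ltr1n.
pose b k := ((M ^+ k)%:E * c k)%E.
have b0 k : (0 <= b k)%E by rewrite mule_ge0// lee_fin exprn_ge0// ltW.
have bS k : (b k <= b k.+1)%E.
  rewrite /b exprSr EFinM -muleA; apply: lee_wpmul2l; first by rewrite lee_fin exprn_ge0// ltW.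
  exact: square_difference_shellS.
have mI u k : measurable_fun (shell k)
    (fun h => ((enorm h `^ (- (N%:R + u * 2)))%:E * square_difference f h)%E).
  exact: measurable_funS (measurable_energy_integrand u).
have mS k : measurable_fun (shell k) (square_difference f).
  by apply: measurable_funS (measurable_square_difference mRe mIm).
have splitE u : energy ball0 u = (\sum_(0 <= k <oo) energy (shell k) u)%E.
  rewrite /energy ge0_integral_bigcup//.
  - exact: measurable_shell.
  - exact: measurable_funS (measurable_energy_integrand u).
  - exact: trivIset_shell.
have a0 (u : R) : 0 < u -> 0 <= N%:R + u * 2 by move=> u0; rewrite addr_ge0// mulr_ge0// ltW.
(* The upper bound of the weight on shell [k] is [(M * q) ^+ k.+1]; of the surplus factor [M * q],
   [q <= 1] is dropped and [M] is kept. *)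
have up : (energy ball0 s <= M%:E * \sum_(0 <= k <oo) (q ^+ k)%:E * b k)%E.
  rewrite splitE -nneseriesZl; last first.
    by move=> k _; rewrite mule_ge0// lee_fin exprn_ge0// ltW.
  apply: lee_nneseries => [k _ _|k _]; first exact: energy_ge0.
  apply: (@le_trans _ _ (\int[mu]_(h in shell k)
    (((M * q) ^+ k.+1)%:E * square_difference f h))%E).
    apply: ge0_le_integral => //.
    - exact: measurable_shell.
    - exact: measurable_funeM.
    - move=> h hk; apply: lee_wpmul2r; first exact: square_difference_ge0.
      by rewrite lee_fin -powR2_scale; have /andP[] := shell_weight (a0 s s0) hk.
  rewrite ge0_integralZl//; last 3 first.
  - exact: measurable_shell.
  - by move=> h _; exact: square_difference_ge0.
  - by rewrite lee_fin exprn_ge0// mulr_ge0// ltW.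
  rewrite /b !muleA -!EFinM; apply: lee_wpmul2r; first exact: c_ge0.
  have qW := ltW q0; have MW := ltW M0.
  rewrite lee_fin exprS exprMn.
  rewrite [leLHS](_ : _ = q * (M * q ^+ k * M ^+ k)); last by ring.
  by rewrite ler_piMl ?mulr_ge0 ?exprn_ge0//; exact: ltW (le_lt_trans qr r1).
(* The lower bound of the weight is [(M * r) ^+ k], so this direction loses no constant. *)
have low : (\sum_(0 <= k <oo) (r ^+ k)%:E * b k <= energy ball0 t)%E.
  rewrite splitE; apply: lee_nneseries => [k _ _|k _].
    by rewrite mule_ge0// lee_fin exprn_ge0// powR_ge0.
  rewrite /b muleA -EFinM -exprMn /c -ge0_integralZl//; last 3 first.
  - exact: measurable_shell.
  - by move=> h _; exact: square_difference_ge0.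
  - by rewrite lee_fin exprn_ge0// mulr_ge0 ?powR_ge0// ltW.
  apply: ge0_le_integral => //.
  - exact: measurable_shell.
  - move=> h _; apply: mule_ge0; last exact: square_difference_ge0.
    by rewrite lee_fin exprn_ge0// mulr_ge0 ?powR_ge0// ltW.
  - exact: measurable_funeM.
  - move=> h hk; apply: lee_wpmul2r; first exact: square_difference_ge0.
    rewrite lee_fin [r * M]mulrC -powR2_scale.
    by have /andP[] := shell_weight (a0 t t0) hk.
have l0 : (0:R) < ln 4 by rewrite ln_gt0// ltr1n.
have S0 x : 0 <= x -> (0 <= \sum_(0 <= k <oo) (x ^+ k)%:E * b k)%E.
  by move=> x0; apply: nneseries_ge0 => k _ _; rewrite mule_ge0// lee_fin exprn_ge0.
have rM : (0 <= \sum_(0 <= k <oo) (r ^+ k)%:E * b k)%E by rewrite S0// powR_ge0.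
have qM : (0 <= \sum_(0 <= k <oo) (q ^+ k)%:E * b k)%E by rewrite S0// powR_ge0.
have mono := geometric_mean_mono q0 qr r1 b0 bS.
apply: (@le_trans _ _ ((1 - s)%:E * (M%:E * \sum_(0 <= k <oo) (q ^+ k)%:E * b k))%E).
  by apply: lee_wpmul2l up; rewrite lee_fin subr_ge0 ltW.
(* Trade [1 - s] for [1 - q] at the cost of [(1 + ln 4) / ln 4]; trading [1 - r] back for [1 - t] at
   the end costs [ln 4], which cancels the denominator. *)
apply: (@le_trans _ _ ((M * (1 + ln 4) / ln 4)%:E *
    ((1 - q)%:E * \sum_(0 <= k <oo) (q ^+ k)%:E * b k))%E).
  rewrite !muleA -!EFinM; apply: (lee_wpmul2r qM); rewrite lee_fin.
  have := @one_sub_powR4_ge R (1 - s); rewrite -/q => /(_ _ _) H.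
  have {}H : (1 - s) * ln 4 <= (1 + ln 4) * (1 - q) by apply: H; lra.
  rewrite [leRHS](_ : _ = M * ((1 + ln 4) * (1 - q)) / ln 4); last by ring.
  rewrite ler_pdivlMr// (mulrC (1 - s)) -mulrA ler_wpM2l//; exact: ltW.
apply: (@le_trans _ _ ((M * (1 + ln 4) / ln 4)%:E *
    ((1 - r)%:E * \sum_(0 <= k <oo) (r ^+ k)%:E * b k))%E).
  apply: lee_wpmul2l; last exact: mono.
  by rewrite lee_fin !mulr_ge0 ?ltW ?invr_gt0// addr_gt0.
rewrite !muleA -!EFinM; apply: lee_pmul; [|exact: rM| |exact: low].
  by rewrite lee_fin !mulr_ge0 ?subr_ge0 ?ltW ?invr_gt0// addr_gt0.
rewrite lee_fin -(mulrA _ _ (1 - r)) ler_wpM2l//.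
  by rewrite !mulr_ge0 ?ltW// addr_gt0.
rewrite mulrC ler_pdivrMr//.
exact: one_sub_powR4_le.
Qed.

End energy.

(** * The inequality for squared norms *)

Section energy_bound.
Context {R : realType} (N : nat).
Local Notation mu := (@lebesgue_rV R N).
Variable f : 'rV[R]_N -> R[i].
Hypothesis mRe : measurable_fun setT (fun x => complex.Re (f x)).
Hypothesis mIm : measurable_fun setT (fun x => complex.Im (f x)).

Local Notation ball0 := (\bigcup_k @shell R N k).
Local Notation L2 := (\int[mu]_x (cmod (f x) ^+ 2)%:E)%E.

Definition energy_const (n : nat) : R :=
  4 ^+ n.+1 * (1 + ln 4) / ln 4 + 2 ^+ (n + 2) * (1 + ln 4).

(** For [0 < enorm h <= 1] the weight increases with the exponent parameter. *)
Lemma energy_near_mono s t : s <= t -> (energy f ball0 s <= energy f ball0 t)%E.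
Proof.
move=> st; apply: ge0_le_integral.
- by apply: bigcup_measurable => k _; exact: measurable_shell.
- by move=> h _; rewrite mule_ge0 ?square_difference_ge0// lee_fin powR_ge0.
- exact: measurable_funS (measurable_energy_integrand mRe mIm s).
- exact: measurable_funS (measurable_energy_integrand mRe mIm t).
move=> h [k _ /andP[h0 h1]].
apply: lee_wpmul2r; first exact: square_difference_ge0.
rewrite lee_fin; apply: ger_powR; last by rewrite lerN2 lerD2l ler_pM2r.
have p : 0 < enorm h by apply: lt_trans h0; rewrite exprn_gt0.
by rewrite p/=; apply: le_trans h1 _; apply: exprn_ile1; lra.
Qed.

Lemma energy_bound s t : 0 < s -> s <= t -> t < 1 ->
  ((Num.min s (1 - s))%:E * energy f setT s <=
   (energy_const N)%:E * (L2 + (Num.min t (1 - t))%:E * energy f setT t))%E.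
Proof.
move=> s0 st t1.
have t0 := lt_le_trans s0 st; have s1 := le_lt_trans st t1.
have l0 : (0:R) < ln 4 by rewrite ln_gt0// ltr1n.
have L0 : (0 <= L2)%E by apply: integral_ge0 => x _; rewrite lee_fin sqr_ge0.
have mb : measurable ball0 by apply: bigcup_measurable => k _; exact: measurable_shell.
have mt0 : 0 <= Num.min t (1 - t) by rewrite le_min; lra.
have X0 : (0 <= (Num.min t (1 - t))%:E * energy f setT t)%E.
  by rewrite mule_ge0// energy_ge0.
set A : R := 4 ^+ N.+1 * (1 + ln 4) / ln 4; set B : R := 2 ^+ (N + 2) * (1 + ln 4).
have A0 : 0 <= A by rewrite !mulr_ge0 ?invr_ge0 ?exprn_ge0//; lra.
have B1 : 1 <= B.
  by rewrite -[1]mulr1 ler_pM//; [rewrite exprn_ege1// ler1n|lra].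
have far : ((Num.min s (1 - s))%:E * energy f (~` ball0) s <= A%:E * L2)%E.
  apply: le_trans (energy_far mRe mIm s0 s1).
  by apply: lee_wpmul2r; [exact: energy_ge0|rewrite lee_fin ge_min lexx].
have near : ((Num.min s (1 - s))%:E * energy f ball0 s <=
    B%:E * ((Num.min t (1 - t))%:E * energy f setT t))%E.
  apply: (@le_trans _ _ (B%:E * ((Num.min t (1 - t))%:E * energy f ball0 t))%E); last first.
    apply: lee_wpmul2l; first by rewrite lee_fin; lra.
    by apply: lee_wpmul2l; [rewrite lee_fin|exact: energy_le].
  (* For [t <= 1/2] both minima are the parameters themselves, and monotonicity of the near energy
     suffices because [B >= 1]. For [t > 1/2] the minimum at [t] is [1 - t], the one at [s] is at
     most [1 - s], and [energy_near] applies. *)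
  have [t2|t2] := leP t 2^-1.
    rewrite !min_l; [|lra|lra].
    apply: (@le_trans _ _ (t%:E * energy f ball0 t)%E).
      apply: lee_pmul.
      - by rewrite lee_fin ltW.
      - exact: energy_ge0.
      - by rewrite lee_fin.
      - exact: energy_near_mono.
    rewrite muleA -EFinM; apply: lee_wpmul2r; first exact: energy_ge0.
    by rewrite lee_fin ler_peMl// ltW.
  rewrite (@min_r _ _ t); last lra.
  apply: le_trans (energy_near mRe mIm s0 st t1).
  by apply: lee_wpmul2r; [exact: energy_ge0|rewrite lee_fin ge_min lexx orbT].
rewrite (energy_split mRe mIm) ge0_muleDr ?energy_ge0//.
rewrite /energy_const -/A -/B.
apply: le_trans (leeD near far) _.
have B0 : 0 <= B by lra.
rewrite EFinD ge0_muleDl ?lee_fin// [leRHS]addeC.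
by apply: leeD; apply: lee_wpmul2l; rewrite ?lee_fin// ?leeDl ?leeDr.
Qed.

End energy_bound.

(** * Passage from squared norms to norms *)

Section seminorms.
Context {R : realType}.

(** For finite values, expanding the square of the right-hand side gives [x + y] plus a nonnegative
    cross term; an infinite value makes the right-hand side infinite. *)
Lemma poweR12_subadditive (x y : \bar R) : (0 <= x)%E -> (0 <= y)%E ->
  ((x + y) `^ 2^-1 <= x `^ 2^-1 + y `^ 2^-1)%E.
Proof.
have h0 : (2^-1 : R) != 0 by rewrite invr_neq0.
have hN z : (z `^ 2^-1 != -oo :> \bar R)%E.
  by rewrite gt_eqF// (lt_le_trans _ (poweR_ge0 _ _)).
case: x => [x||]//; last first.
  by move=> _ _; rewrite [X in (_ <= X + _)%E]poweRyr// [leRHS]addye ?leey.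
case: y => [y||]//; last first.
  by move=> _ _; rewrite [X in (_ <= _ + X)%E]poweRyr// [leRHS]addey ?leey.
rewrite -EFinD !poweR_EFin -EFinD !lee_fin => x0 y0.
rewrite !powR12_sqrt ?addr_ge0//.
rewrite -[leRHS]ger0_norm ?addr_ge0 ?sqrtr_ge0// -sqrtr_sqr ler_wsqrtr//.
by rewrite sqrrD !sqr_sqrtr// lerD2r lerDl mulrn_wge0// mulr_ge0 ?sqrtr_ge0.
Qed.

Lemma L2_normE N (f : 'rV[R]_N -> R[i]) :
  L2_norm f = ((\int[@lebesgue_rV R N]_x (cmod (f x) ^+ 2)%:E) `^ 2^-1)%E.
Proof.
rewrite /L2_norm unlock; congr (_ `^ _)%E; apply: eq_integral => x _ /=.
by rewrite -[2]/(2%:R) powR_mulrn ?normr_ge0// ger0_norm// cmod_ge0.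
Qed.

Lemma gagliardo_seminormE N (f : 'rV[R]_N -> R[i]) s :
  measurable_fun setT (fun x => complex.Re (f x)) ->
  measurable_fun setT (fun x => complex.Im (f x)) ->
  gagliardo_seminorm s 2 f = (energy f setT s `^ 2^-1)%E.
Proof. by move=> mRe mIm; rewrite /gagliardo_seminorm gagliardo_integralE. Qed.

Lemma measurable_real_schwartz N (g : 'rV[R]_N -> R) :
  real_schwartz g -> measurable_fun setT g.
Proof. by case=> /(_ [::])[cg _] _; exact: continuous_measurable_rV. Qed.

End seminorms.

Theorem corollary1p3 (R : realType) (N : nat) (hN : (1 <= N)%N) :
  exists2 C : R, 0 < C &
  forall s t : R, 0 < s -> s <= t -> t < 1 ->
  forall f : 'rV[R]_N -> R[i], schwartz f ->
  (((Num.min s (1 - s)) `^ 2^-1)%:E * gagliardo_seminorm s 2 f <=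
   C%:E * (L2_norm f + ((Num.min t (1 - t)) `^ 2^-1)%:E * gagliardo_seminorm t 2 f))%E.
Proof.
have l0 : (0:R) < ln 4 by rewrite ln_gt0// ltr1n.
have K0 : 0 < energy_const (R := R) N.
  by rewrite addr_gt0// !mulr_gt0 ?invr_gt0 ?exprn_gt0//; lra.
(* [energy_bound] concerns squares, hence the square root of its constant. *)
exists (energy_const N `^ 2^-1); first by rewrite powR_gt0.
move=> s t s0 st t1 f [/measurable_real_schwartz mRe /measurable_real_schwartz mIm].
have t0 := lt_le_trans s0 st.
have ms0 : 0 <= Num.min s (1 - s) by rewrite le_min; lra.
have mt0 : 0 <= Num.min t (1 - t) by rewrite le_min; lra.
have L0 : (0 <= \int[@lebesgue_rV R N]_x (cmod (f x) ^+ 2)%:E)%E.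
  by apply: integral_ge0 => x _; rewrite lee_fin sqr_ge0.
rewrite !gagliardo_seminormE// L2_normE -!poweR_EFin.
rewrite -!poweRM ?lee_fin ?energy_ge0//.
have X0 := mule_ge0 (mt0 : (0 <= (Num.min t (1 - t))%:E)%E) (energy_ge0 f setT t).
apply: le_trans (lee_wpmul2l _ (poweR12_subadditive L0 X0)); last exact: poweR_ge0.
rewrite -poweRM; [|by rewrite lee_fin ltW|exact: adde_ge0].
have EK := energy_bound mRe mIm s0 st t1.
have E0 : (0 <= (Num.min s (1 - s))%:E * energy f setT s)%E.
  by rewrite mule_ge0 ?lee_fin ?energy_ge0.
by apply: gt0_ler_poweR => //; rewrite in_itv/= leey andbT//; exact: le_trans EK.
Qed.
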